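(* Let $(X,d)$ be a complete semimetric space with an upper semicontinuous triangle function $\Phi\colon\mathbb{R}_+^2\to\mathbb{R}_+$ for $d$. Then $(\mathscr{K}(X),D)$ is also complete.
   Context: $\mathbb{R}_+=[0,\infty)$. A semimetric space $(X,d)$ is a nonempty set $X$ with a symmetric function $d:X\times X\to\mathbb{R}_+$ such that $d(x,y)=0$ if and only if $x=y$ (no triangle inequality is assumed). A triangle function for $d$ is a symmetric function $\Phi:\mathbb{R}_+^2\to[0,\infty]$, monotone increasing (in the weak sense) in both arguments, with $\Phi(0,0)=0$ and $d(x,y)\le\Phi(d(x,z),d(z,y))$ for all $x,y,z\in X$; here $\Phi$ is assumed to be finite-valued. A sequence $(x_n)$ converges to $x$ if $d(x_n,x)\to0$; it is Cauchy if for every $\varepsilon>0$ there is $n_0$ with $d(x_n,x_m)<\varepsilon$ for $n,m\ge n_0$; the space is complete if every Cauchy sequence converges to some element of the space. For $p\in X$ and $r\in(0,\infty]$, the ball is $\mathscr{B}(p,r)=\{x\in X: d(x,p)<r\}$. A set $A\subseteq X$ is open if for every $p\in A$ there is $r>0$ with $\mathscr{B}(p,r)\subseteq A$; the open sets form a topology on $X$ (balls need not be open). A set is compact if each of its covers by open sets has a finite subcover; $\mathscr{K}(X)$ is the family of all nonempty compact subsets of $X$. For nonempty $A,B\subseteq X$ the Hausdorff--Pompeiu distance is $$D(A,B)=\inf\Bigl\{\varepsilon\in(0,\infty]\ \Big|\ A\subseteq\bigcup_{b\in B}\mathscr{B}(b,\varepsilon),\ B\subseteq\bigcup_{a\in A}\mathscr{B}(a,\varepsilon)\Bigr\}.$$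 Under the hypotheses, $D$ restricted to $\mathscr{K}(X)$ is a semimetric, and completeness of $(\mathscr{K}(X),D)$ is understood with respect to it. *)

(* Defs.v *)
From HB Require Import structures.
From mathcomp Require Import all_boot all_order all_algebra.
From mathcomp Require Import all_classical all_reals.
From mathcomp Require Import ereal topology normedtype sequences.

Set Implicit Arguments.
Unset Strict Implicit.
Unset Printing Implicit Defensive.

Import Order.TTheory GRing.Theory Num.Theory.
Import numFieldNormedType.Exports.

Local Open Scope classical_set_scope.
Local Open Scope ring_scope.

Record is_semimetric (R : realType) (X : Type) (d : X -> X -> R) : Prop := {
  semimetric_nonempty : [set: X] !=set0;
  semimetric_ge0 : forall x y, 0 <= d x y;
  semimetric_sym : forall x y, d x y = d y x;
  semimetric_eq0 : forall x y, d x y = 0 <-> x = y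
}.

(* Phi is a function on the closed quadrant `[0, +oo[ ^ 2: it is a total
   function on R * R whose values outside the quadrant are never used. *)
Record is_triangle_function (R : realType) (X : Type) (d : X -> X -> R)
    (Phi : R -> R -> R) : Prop := {
  triangle_ge0 : forall u v, 0 <= u -> 0 <= v -> 0 <= Phi u v;
  triangle_sym : forall u v, 0 <= u -> 0 <= v -> Phi u v = Phi v u;
  triangle_mono : forall u u' v v', 0 <= u -> u <= u' -> 0 <= v -> v <= v' ->
    Phi u v <= Phi u' v';
  triangle_00 : Phi 0 0 = 0;
  triangle_le : forall x y z, d x y <= Phi (d x z) (d z y)
}.

Definition quadrant (R : realType) : set (R * R) :=
  [set z | 0 <= z.1 /\ 0 <= z.2].

Definition upper_semicontinuous_on (R : realType) (T : topologicalType)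
    (D : set T) (f : T -> R) : Prop :=
  forall x, D x -> forall a, f x < a -> \forall z \near within D (nbhs x), f z < a.

Definition sball (R : realType) (X : Type) (d : X -> X -> R) (p : X)
    (r : \bar R) : set X := [set x | ((d x p)%:E < r)%E].

Definition sopen (R : realType) (X : Type) (d : X -> X -> R) (A : set X) : Prop :=
  forall p, A p -> exists2 r : \bar R, (0 < r)%E & sball d p r `<=` A.

(* X endowed with the topology of the sets that are open for d. *)
Definition semitop (R : realType) (X : Type) (d : X -> X -> R) : Type := X.

HB.instance Definition _ (R : realType) (X : Type) (d : X -> X -> R) :=
  gen_eqMixin (semitop d).
HB.instance Definition _ (R : realType) (X : Type) (d : X -> X -> R) :=
  gen_choiceMixin (semitop d).

Fact sopenT (R : realType) (X : Type) (d : X -> X -> R) : sopen d setT.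
Proof. by move=> p _; exists 1%E => //; rewrite lte01. Qed.

Fact sopenI (R : realType) (X : Type) (d : X -> X -> R) : setI_closed (sopen d).
Proof.
move=> A B oA oB p [/oA[r r0 rA] /oB[s s0 sB]].
exists (Order.min r s); first by rewrite lt_min r0.
by move=> x; rewrite /sball/= lt_min => /andP[xr xs]; split; [exact: rA|exact: sB].
Qed.

Fact sopen_bigU (R : realType) (X : Type) (d : X -> X -> R) (I : Type)
  (f : I -> set X) : (forall i, sopen d (f i)) -> sopen d (\bigcup_i f i).
Proof.
move=> of_ p [i _ /of_[r r0 rf]]; exists r => // x /rf fx.
by exists i.
Qed.

HB.instance Definition _ (R : realType) (X : Type) (d : X -> X -> R) :=
  isOpenTopological.Build (semitop d) (@sopenT R X d) (@sopenI R X d)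
    (@sopen_bigU R X d).

Fact open_semitop (R : realType) (X : Type) (d : X -> X -> R) (A : set X) :
  @open (semitop d) A = sopen d A.
Proof. by []. Qed.

Definition compacts (R : realType) (X : Type) (d : X -> X -> R) : Type :=
  {A : set X | A !=set0 /\ @cover_compact (semitop d) A}.

Definition hausdorff (R : realType) (X : Type) (d : X -> X -> R)
    (A B : set X) : \bar R :=
  ereal_inf [set e : \bar R | [/\ (0 < e)%E,
    A `<=` \bigcup_(b in B) sball d b e &
    B `<=` \bigcup_(a in A) sball d a e]].

(* The three notions below are stated for an extended-real-valued distance rho,
   so that they apply verbatim both to d and to the Hausdorff-Pompeiu distance,
   which is finite on compact sets only under suitable hypotheses. *)
Definition converges_to (R : realType) (T : Type) (rho : T -> T -> \bar R)
    (u : nat -> T) (x : T) : Prop :=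
  rho (u n) x @[n --> \oo] --> 0%E.

Definition cauchy_seq (R : realType) (T : Type) (rho : T -> T -> \bar R)
    (u : nat -> T) : Prop :=
  forall e : R, 0 < e -> exists n0 : nat, forall n m : nat,
    (n0 <= n)%N -> (n0 <= m)%N -> (rho (u n) (u m) < e%:E)%E.

Definition complete_dist (R : realType) (T : Type) (rho : T -> T -> \bar R) : Prop :=
  forall u : nat -> T, cauchy_seq rho u -> exists x : T, converges_to rho u x.

(* Main.v *)
Require Import Defs.
From mathcomp Require Import all_boot all_order all_algebra.
From mathcomp Require Import finmap.
From mathcomp Require Import all_classical all_reals.
From mathcomp Require Import ereal topology normedtype sequences.

Import Order.TTheory GRing.Theory Num.Theory.
Import numFieldNormedType.Exports.

Local Open Scope classical_set_scope.
Local Open Scope ring_scope.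

(* Upper semicontinuity at (0, 0) makes Phi small near the origin, so d behaves
   like a metric up to a change of radii, and the classical argument applies:
   a Cauchy sequence (K n) of compact sets converges to its lower limit L, the
   set of points with neighbours in all late K n. Points of a late K n are
   joined to L by chains with rapidly decreasing steps, and L is compact because
   it is closed and inherits total boundedness from the K n. *)

(** A successor exists only under the invariant [P], so choice is applied to the implication, which
    is total in the pair of index and point. *)
Lemma invariant_dependent_choice (T : Type) (P : nat -> T -> Prop)
    (Q : nat -> T -> T -> Prop) (x0 : T) :
  P 0%N x0 ->
  (forall n x, P n x -> exists y, P n.+1 y /\ Q n x y) ->
  exists u : nat -> T,
    u 0%N = x0 /\ forall n, P n (u n) /\ Q n (u n) (u n.+1).
Proof.
move=> P0 step.
have /choice[g gP] (p : nat * T) :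
    exists y, P p.1 p.2 -> P p.1.+1 y /\ Q p.1 p.2 y.
  have [/step[y yP]|nP] := pselect (P p.1 p.2); first by exists y.
  by exists p.2.
pose u := fix u n := if n is m.+1 then g (m, u m) else x0.
have Pu n : P n (u n) by elim: n => [//|n /(gP (n, _))[]].
by exists u; split=> // n; split=> //; have [] := gP (n, u n) (Pu n).
Qed.

Section small_triangles.
Context {R : realType} {X : Type}.
Implicit Types (d : X -> X -> R) (A B : set X) (e : R).

(* Together with symmetry, this says that the sets [d x y < e] generate a
   uniformity. *)
Definition small_triangles d := forall e, 0 < e -> exists2 r, 0 < r &
  forall x y z, d x z < r -> d z y < r -> d x y < e.

Definition within_dist d e A B := forall a, A a -> exists2 b, B b & d a b < e.

(** The centres may lie outside [A], so that a net of one set can serve a nearby one. *)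
Definition totally_bounded_dist d A := forall e, 0 < e ->
  exists s : seq (semitop d), within_dist d e A [set p | p \in s].

Definition adherent d A (x : X) := forall e, 0 < e -> exists2 y, A y & d x y < e.

Definition eventually_near d (K : nat -> set X) (x : X) := forall e, 0 < e ->
  exists N : nat, forall n : nat, (N <= n)%N -> exists2 y, K n y & d x y < e.

(** By upper semicontinuity and [Phi 0 0 = 0], [Phi (r / 2) (r / 2) < e] for some [r]; monotonicity
    extends the bound to all smaller arguments. *)
Lemma small_triangles_usc d (Phi : R -> R -> R) : is_semimetric d ->
  is_triangle_function d Phi ->
  upper_semicontinuous_on (quadrant (R := R)) (fun z => Phi z.1 z.2) ->
  small_triangles d.
Proof.
move=> dm [_ _ Pmono P00 Ple] usc e e0.
have quadrant0 : quadrant ((0, 0) : R * R) by split => /=.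
have /usc : quadrant ((0, 0) : R * R) by [].
move=> /(_ e); rewrite /= P00 => /(_ e0).
rewrite /prop_near1 /within /= => /nbhs_ballP[r /= r0 rP].
have r20 : 0 < r / 2 by rewrite divr_gt0.
exists (r / 2) => // x y z xz zy.
apply: (le_lt_trans (Ple x y z)).
apply: (@le_lt_trans _ _ (Phi (r / 2) (r / 2))).
  by apply: Pmono; rewrite ?(semimetric_ge0 dm)// ltW.
have rr : `|0 - r / 2| < r.
  by rewrite sub0r normrN gtr0_norm// ltr_pdivrMr// ltr_pMr// ltr1n.
by apply: (rP (r / 2, r / 2)) => /=; split=> //=; rewrite ltW.
Qed.

Lemma converges_toP (T : Type) (rho : T -> T -> \bar R) (u : nat -> T) (x : T) :
  (forall y z, 0 <= rho y z)%E ->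
  converges_to rho u x <->
  forall e, 0 < e -> exists N : nat, forall n : nat, (N <= n)%N ->
    (rho (u n) x < e%:E)%E.
Proof.
move=> rho0; split.
  move=> /fine_cvgP[[M _ fM] /cvgrPdist_lt cu] e /cu[N _ uN].
  exists (maxn M N) => n; rewrite geq_max => /andP[Mn Nn].
  rewrite -(fineK (fM _ Mn)) lte_fin.
  by have /= := uN _ Nn; rewrite sub0r normrN ger0_norm// fine_ge0.
move=> h; apply/fine_cvgP; split.
  have [N NP] := h 1 ltr01; exists N => // n /= /NP un.
  by rewrite ge0_fin_numE// (lt_trans un)// ltry.
apply/cvgrPdist_lt => e e0; have [N NP] := h e e0; exists N => // n /= /NP.
move: (rho0 (u n) x); case: (rho (u n) x) => [r| |] //=.
by rewrite lee_fin lte_fin sub0r normrN => r0; rewrite ger0_norm.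
Qed.

(** * Hausdorff distance through one-sided neighbourhoods *)

Lemma hausdorff_ge0 d A B : (0 <= hausdorff d A B)%E.
Proof. by apply: le_ereal_inf_tmp => e [/ltW]. Qed.

Lemma hausdorff_le d e A B : is_semimetric d -> 0 < e ->
  within_dist d e A B -> within_dist d e B A -> (hausdorff d A B <= e%:E)%E.
Proof.
move=> dm e0 AB BA; apply: ereal_inf_lbound; split; first by rewrite lte_fin.
  by move=> a /AB[b Bb ab]; exists b => //; rewrite /sball/= lte_fin.
by move=> b /BA[a Aa ba]; exists a => //; rewrite /sball/= lte_fin.
Qed.

Lemma hausdorff_lt_within d e A B :
  (hausdorff d A B < e%:E)%E -> within_dist d e A B.
Proof.
move=> /ereal_inf_lt[r [_ AB _] re] a /AB[b Bb ab]; exists b => //.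
by rewrite -lte_fin (lt_trans ab).
Qed.

(** * Compactness and total boundedness *)

(** Balls need not be open, so [O] collects the points around which some ball stays in the [e]-ball;
    small triangles make this set open. *)
Lemma ball_open_core d (p : X) e : is_semimetric d -> small_triangles d ->
  0 < e -> exists O : set X, [/\ sopen d O, O p & forall x, O x -> d x p < e].
Proof.
move=> dm tri e0.
exists [set x | exists2 s, 0 < s & forall y, d y x < s -> d y p < e].
split; last 1 first.
- move=> x [s s0]; apply; suff -> : d x x = 0 by [].
  exact/(semimetric_eq0 dm).
- move=> x [s s0 sP]; have [r r0 rP] := tri _ s0.
  exists r%:E; first by rewrite lte_fin.
  move=> y; rewrite /sball/= lte_fin => yx; exists r => // z zy.
  exact/sP/(rP z x y).
- by exists e.
Qed.

(** The open cores of all [e]-balls cover [A]; the centres of a finite subcover form the net. *)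
Lemma compact_totally_bounded d A : is_semimetric d -> small_triangles d ->
  @cover_compact (semitop d) A -> totally_bounded_dist d A.
Proof.
move=> dm tri cA e e0.
have /choice[O OP] (p : X) := ball_open_core d p e dm tri e0.
have [||s _ sA] := cA (semitop d) setT O.
- by move=> p _; have [] := OP p.
- by move=> a Aa; exists a => //; have [] := OP a.
exists (enum_fset s) => a /sA[p ps Opa]; exists p => //.
by have [_ _] := OP p; apply.
Qed.

(** In contrapositive form: when finitely many pieces make up a set with no finite subcover, some
    piece has none either. *)
Lemma finite_subset_cover_pieces (T : Type) (I : choiceType) (J : eqType)
    (D : set I) (f : I -> set T) (g : J -> set T) (s : seq J) :
  (forall j, finite_subset_cover D f (g j)) ->
  finite_subset_cover D f [set a | exists2 j, j \in s & g j a].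
Proof.
move=> gP; elim: s => [|j s [E ED EP]].
  by exists fset0%fset => [i|a []]; rewrite ?inE.
have [F FD FP] := gP j; exists (F `|` E)%fset.
  by move=> i; rewrite in_fsetU => /orP[/FD|/ED].
move=> a [k]; rewrite inE => /orP[/eqP -> /FP|ks ga].
  by move=> [i /= iF fia]; exists i => //=; rewrite in_fsetU iF.
have /EP[i /= iE fia] : exists2 k, k \in s & g k a by exists k.
by exists i => //=; rewrite in_fsetU iE orbT.
Qed.

Lemma complete_cauchy_limit d (u : nat -> X) : is_semimetric d ->
  complete_dist (fun x y => (d x y)%:E) ->
  (forall e, 0 < e -> exists N : nat, forall n m : nat,
    (N <= n)%N -> (N <= m)%N -> d (u n) (u m) < e) ->
  exists x, forall e, 0 < e -> exists N : nat, forall n : nat, (N <= n)%N ->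
    d (u n) x < e.
Proof.
move=> dm cplt cu.
have [|x /converges_toP ux] := cplt u.
  by move=> e /cu[N uN]; exists N => n m Nn Nm; rewrite lte_fin uN.
exists x => e e0.
have [|N uN] := ux _ e e0; first by move=> *; rewrite lee_fin (semimetric_ge0 dm).
by exists N => n /uN; rewrite lte_fin.
Qed.

(* If no finite subfamily covered A, one could shrink A to subsets of smaller
   and smaller diameter with the same defect; they accumulate at a point of A,
   a neighbourhood of which is contained in a single member of the cover. *)
Lemma complete_totally_bounded_compact d A : is_semimetric d ->
  small_triangles d -> complete_dist (fun x y => (d x y)%:E) ->
  totally_bounded_dist d A -> adherent d A `<=` A ->
  @cover_compact (semitop d) A.
Proof.
move=> dm tri cplt tbA clA I D f fop fA; apply: contrapT => badA.
pose bad (S : set X) := S `<=` A /\ ~ finite_subset_cover D f S.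
have [||S [_ SP]] := @invariant_dependent_choice (set X) (fun=> bad)
  (fun n S S' => S' `<=` S /\
     exists p, forall x, S' x -> d x p < n.+1%:R^-1) A.
- by split.
- move=> n S [SA badS].
  have [|s sP] := tbA n.+1%:R^-1; first by rewrite invr_gt0.
  suff [p badp] : exists p : semitop d,
      ~ finite_subset_cover D f (S `&` [set x | d x p < n.+1%:R^-1]).
    exists (S `&` [set x | d x p < n.+1%:R^-1]); split.
      by split=> // x [/SA].
    by split=> [x []//|]; exists p => x [].
  apply/existsNP => piece; apply: badS.
  have [E ED EP] := finite_subset_cover_pieces _ _ _ _ _ _ s piece.
  exists E => // x Sx; apply: EP; have [p ps xp] := sP _ (SA _ Sx).
  by exists p.
(* The empty subfamily covers the empty set, so no bad set is empty. *)
have Snonempty n : exists x, S n x.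
  apply: contrapT => S0; have [[_]] := SP n; case.
  by exists fset0%fset => [i|x Sx]; [rewrite inE|case: S0; exists x].
have /choice[y yP] := Snonempty.
have Sdecr n m : (n <= m)%N -> S m `<=` S n.
  move=> /subnK <-; elim: (m - n)%N => [//|k ih] x Sx; apply: ih.
  by have [_ [+ _]] := SP (k + n)%N; apply.
have Ssmall e : 0 < e -> exists k, forall x x', S k x -> S k x' -> d x x' < e.
  move=> /tri[r r0 rP]; have [k kr] := ltr_add_invr r0.
  (* Step [k] bounds [S k.+1], whence the shift. *)
  exists k.+1 => x x' Sx Sx'; have [_ [_ [p pP]]] := SP k.
  by rewrite add0r in kr; apply: (rP x x' p); rewrite 1?(semimetric_sym dm p);
    apply: (lt_trans _ kr); exact: pP.
have [|x yx] := complete_cauchy_limit d y dm cplt.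
  move=> e /Ssmall[k kP]; exists k => n m kn km.
  by apply: kP; [exact: (Sdecr _ _ kn)|exact: (Sdecr _ _ km)].
have Ax : A x.
  apply: clA => e /yx[N yN]; exists (y N); last first.
    by rewrite (semimetric_sym dm) yN.
  by have [[SA _] _] := SP N; exact: SA.
have [i Di fiDx] := fA _ Ax.
have [r r0 rf] := fop _ Di _ fiDx.
(* The radius [r] may be infinite; it is replaced by a positive real. *)
have [t t0 tr] : exists2 t : R, 0 < t & (t%:E <= r)%E.
  case: r r0 {rf} => [t| |] // t0; first by exists t; rewrite ?lexx// -lte_fin.
  by exists 1; rewrite ?leey.
have [s s0 sP] := tri _ t0.
have [k kP] := Ssmall _ s0.
have [N yN] := yx _ s0.
have [[_ badS] _] := SP k; apply: badS.
(* [S k] lies within [t] of [x], hence in [f i]: a single member covers it. *)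
exists [fset i]%fset => [j|z Sz]; first by rewrite in_fset1 => /eqP ->; exact: mem_set.
exists i; first by rewrite /= inE.
apply: rf; rewrite /sball/=; apply: (lt_le_trans _ tr); rewrite lte_fin.
apply: (sP z x (y (maxn k N))); last by rewrite yN// leq_maxr.
by apply: kP => //; apply: (Sdecr k (maxn k N)) => //; rewrite leq_maxl.
Qed.

(* The step from [k.+1] to [k] in the triangle estimate telescopes along a
   chain with consecutive distances below [r k.+1]. *)
Lemma small_triangles_radii d : small_triangles d -> exists r : nat -> R,
  [/\ forall k, 0 < r k,
      forall k x y z, d x z < r k.+1 -> d z y < r k.+1 -> d x y < r k &
      forall e, 0 < e -> exists N : nat, forall k : nat, (N <= k)%N -> r k < e].
Proof.
move=> tri.
have [||r [_ rP]] := @invariant_dependent_choice R (fun _ e => 0 < e)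
  (fun n e e' => e' < n.+1%:R^-1 /\
     forall x y z, d x z < e' -> d z y < e' -> d x y < e) 1.
- exact: ltr01.
- move=> n e /tri[s s0 sP].
  have n0 : 0 < n.+2%:R^-1 :> R by rewrite invr_gt0.
  (* The cap keeps the next radius below [n.+1%:R^-1], so the radii tend to 0. *)
  exists (Num.min s n.+2%:R^-1); split; first by rewrite lt_min s0.
  split; first by rewrite gt_min ltf_pV2 ?posrE// ltr_nat ltnSn orbT.
  by move=> x y z; rewrite !lt_min => /andP[xz _] /andP[zy _]; exact: sP zy.
exists r; split; first by move=> k; have [] := rP k.
  by move=> k; have [_ []] := rP k.
move=> e e0; have [N] := ltr_add_invr e0; rewrite add0r => Ne.
exists N.+1 => -[//|k] Nk; have [_ [rk _]] := rP k.
apply: (lt_trans rk); apply: le_lt_trans Ne.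
by rewrite lef_pV2 ?posrE// ler_nat.
Qed.

Lemma adherent_eventually_near d (K : nat -> set X) : small_triangles d ->
  adherent d (eventually_near d K) `<=` eventually_near d K.
Proof.
move=> tri x xL e /tri[r r0 rP]; have [y yL xy] := xL r r0.
have [N NP] := yL r r0; exists N => n /NP[z Kz yz].
by exists z => //; exact: rP yz.
Qed.

(** * Hausdorff limit of a Cauchy sequence of sets *)

Section hausdorff_limit.
Context (d : X -> X -> R) (K : nat -> set X).
Context (dm : is_semimetric d) (tri : small_triangles d).
Context (K_cauchy : forall e, 0 < e -> exists N : nat, forall n m : nat,
  (N <= n)%N -> (N <= m)%N -> within_dist d e (K n) (K m)).

(** Close to [x] there is a point of some very late set, and the Cauchy condition leads from it back
    to [K n]; thus [N] depends on [e] only. *)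
Lemma eventually_near_within e : 0 < e -> exists N : nat, forall n : nat,
  (N <= n)%N -> within_dist d e (eventually_near d K) (K n).
Proof.
move=> /tri[r r0 rP]; have [N NP] := K_cauchy r r0; exists N => n Nn x xL.
have [M MP] := xL r r0.
have [y Ky xy] := MP _ (leq_maxr N M).
have [z Kz yz] := NP _ _ (leq_maxl N M) Nn y Ky.
by exists z => //; exact: rP yz.
Qed.

(** A chain from [y] through the sets [K (N j)] converges by completeness to a point [l] of the
    lower limit; its radii start so small that [l] is within [e] of [y]. *)
Lemma within_eventually_near e :
  complete_dist (fun x y => (d x y)%:E) -> 0 < e -> exists N : nat,
  forall n : nat, (N <= n)%N -> within_dist d e (K n) (eventually_near d K).
Proof.
move=> cplt e0; have [r [r0 rtri rsmall]] := small_triangles_radii d tri.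
have [w w0 wP] := tri e e0; have [k0 k0P] := rsmall _ w0.
have /choice[M MP] (j : nat) := K_cauchy _ (r0 (k0 + j)%N).
(* Partial sums give a nondecreasing sequence dominating [M]. *)
pose N j := (\sum_(i < j.+1) M i)%N.
have MN j : (M j <= N j)%N by rewrite /N big_ord_recr leq_addl.
have NS j : (N j <= N j.+1)%N by rewrite [N j.+1]/N big_ord_recr leq_addr.
exists (M 2) => n n2 y Ky.
have [x2 Kx2 yx2] := MP 2%N _ _ n2 (MN 2%N) y Ky.
(* The shift by 2 pays for two uses of the triangle estimate: one index is lost in [chain], another
   in [lim_le] when passing to the limit. *)
have [//||x [x0 xP]] := @invariant_dependent_choice X (fun j => K (N j.+2))
  (fun j a b => d a b < r (k0 + j.+2)%N) x2.
  move=> j a Ka.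
  have [b Kb ab] := MP j.+2 _ _ (MN _) (leq_trans (MN _) (NS _)) a Ka.
  by exists b.
have chain m j : d (x j) (x (j + m)%N) < r (k0 + j.+1)%N.
  elim: m j => [|m ih] j.
    by rewrite addn0; have /(semimetric_eq0 dm) -> : x j = x j by [].
  apply: (rtri _ _ _ (x j.+1)); rewrite -addnS; first by have [] := xP j.
  by rewrite addnS -addSn; exact: ih.
have chain_le m j : (j <= m)%N -> d (x j) (x m) < r (k0 + j.+1)%N.
  by move=> /subnKC <-; exact: chain.
have [|l xl] := complete_cauchy_limit d x dm cplt.
  move=> s /tri[t t0 tP]; have [j jP] := rsmall _ t0.
  have jt : r (k0 + j.+1)%N < t.
    by apply: jP; rewrite (leq_trans (leqnSn j))// leq_addl.
  exists j => p q jp jq; apply: (tP _ _ (x j)).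
    by rewrite (semimetric_sym dm); exact: (lt_trans (chain_le _ _ jp)).
  exact: (lt_trans (chain_le _ _ jq)).
have lim_le j : d (x j) l < r (k0 + j)%N.
  have [p pP] := xl _ (r0 (k0 + j).+1).
  apply: (rtri _ _ _ (x (maxn j p))).
    by rewrite -addnS; apply: chain_le; rewrite leq_maxl.
  by apply: pP; rewrite leq_maxr.
exists l.
  (* From [x j] the Cauchy condition leads into every [K m] with [m] at least [M j.+2], not only
     into the sets of the chain. *)
  move=> s /tri[t t0 tP]; have [j jP] := rsmall _ t0.
  exists (M j.+2) => m jm.
  have [Kxj _] := xP j.
  have [z Kz xz] := MP j.+2 _ _ (MN _) jm (x j) Kxj.
  exists z => //; apply: (tP _ _ (x j)).
    by rewrite (semimetric_sym dm); apply: (lt_trans (lim_le j)); rewrite jP// leq_addl.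
  by apply: (lt_trans xz); rewrite jP// (leq_trans (leqW (leqnSn j)))// leq_addl.
apply: (wP _ _ x2).
  by apply: (lt_trans yx2); rewrite k0P// leq_addr.
by rewrite -x0; apply: (lt_trans (lim_le 0%N)); rewrite k0P// leq_addr.
Qed.

End hausdorff_limit.
End small_triangles.

(** * Compactness of the lower limit and convergence to it *)

Theorem theorem9 (R : realType) (X : Type) (d : X -> X -> R)
    (Phi : R -> R -> R)
    (d_semimetric : is_semimetric d)
    (d_complete : complete_dist (fun x y : X => (d x y)%:E))
    (Phi_triangle : is_triangle_function d Phi)
    (Phi_usc : upper_semicontinuous_on (quadrant (R:=R))
       (fun z : R * R => Phi z.1 z.2)) :
  complete_dist (fun A B : compacts d => hausdorff d (sval A) (sval B)).
Proof.
have tri := small_triangles_usc d Phi d_semimetric Phi_triangle Phi_usc.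
move=> u u_cauchy; pose K n := sval (u n).
have K_cauchy e : 0 < e -> exists N : nat, forall n m : nat,
    (N <= n)%N -> (N <= m)%N -> within_dist d e (K n) (K m).
  move=> /u_cauchy[N NP]; exists N => n m Nn Nm.
  exact/hausdorff_lt_within/NP.
have LK := eventually_near_within d K tri K_cauchy.
have KL e := within_eventually_near d K d_semimetric tri K_cauchy e d_complete.
pose L := eventually_near d K.
have L0 : L !=set0.
  have [N NP] := KL 1 ltr01; have [[y Ky] _] := svalP (u N).
  by have [l Ll _] := NP N (leqnn N) y Ky; exists l.
have Lc : @cover_compact (semitop d) L.
  apply: complete_totally_bounded_compact => //; last exact: adherent_eventually_near.
  (* An [r]-net of one late [K N] is an [e]-net of [L], which lies within [r] of [K N]. *)
  move=> e /tri[r r0 rP]; have [N NP] := LK r r0.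
  have [_ cK] := svalP (u N).
  have [s sP] := compact_totally_bounded d (K N) d_semimetric tri cK r r0.
  exists s => x /(NP N (leqnn N))[y /sP[p ps yp] xy].
  by exists p => //; exact: rP yp.
exists (exist _ L (conj L0 Lc)).
apply/converges_toP; first by move=> *; exact: hausdorff_ge0.
move=> e e0; have e20 : 0 < e / 2 by rewrite divr_gt0.
have [M MP] := LK _ e20; have [N NP] := KL _ e20.
exists (maxn M N) => n; rewrite geq_max => /andP[Mn Nn].
(* [hausdorff_le] bounds the infimum only weakly; half of [e] makes the inequality strict. *)
apply: (@le_lt_trans _ _ (e / 2)%:E).
  by apply: hausdorff_le => //=; [exact: NP|exact: MP].
by rewrite lte_fin ltr_pdivrMr// ltr_pMr// ltr1n.
Qed.
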